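(* Let $G=A_n$ or $S_n$ with $n\ge5$ act (as a group of automorphisms) primitively on the set of points of a finite thick generalised quadrangle $\mathcal{Q}$ of order $(s,t)$, and suppose the stabiliser of a point is intransitive on $\{1,\dots,n\}$, so that the points of $\mathcal{Q}$ may be identified with the $k$-subsets of $\{1,\dots,n\}$ for some $k$. Then $n=6$ and $s=t=2$.
   Context: A finite generalised quadrangle is a finite point-line geometry in which every two points lie on at most one line and, for every point $p$ and line $L$ not through $p$, there is a unique point on $L$ collinear with $p$; thick of order $(s,t)$ means every line has $s+1\ge3$ points and every point lies on $t+1\ge3$ lines. *)

(* Defs.v *)
(* MathComp *)
From mathcomp Require Import all_boot all_fingroup all_solvable.

Set Implicit Arguments.
Unset Strict Implicit.
Unset Printing Implicit Defensive.

Section Geometry.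

Variables (P L : finType) (inc : P -> L -> bool).

Definition collinear (p q : P) : Prop := exists l : L, inc p l /\ inc q l.

Record generalised_quadrangle : Prop := GeneralisedQuadrangle {
  gq_line_unique : forall (p q : P) (l m : L), p != q ->
    inc p l -> inc q l -> inc p m -> inc q m -> l = m;
  gq_projection : forall (p : P) (l : L), ~~ inc p l ->
    exists! q : P, inc q l /\ collinear p q
}.

Record thick_of_order (s t : nat) : Prop := ThickOfOrder {
  thick_s : 3 <= s.+1;
  thick_t : 3 <= t.+1;
  points_on_line : forall l : L, #|[set p : P | inc p l]| = s.+1;
  lines_on_point : forall p : P, #|[set l : L | inc p l]| = t.+1
}.

(* The two actions together are a homomorphism from the group to the
   automorphism group of the incidence structure.  *)
Definition acts_as_automorphisms (gT : finGroupType)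
    (toP : {action gT &-> P}) (toL : {action gT &-> L}) : Prop :=
  forall (g : gT) (p : P) (l : L), inc (toP p g) (toL l g) = inc p l.

End Geometry.

(* MathComp's primitivity is stated for total actions, so a group G of
   permutations acts through the finite group type [subg_of G] of its elements;
   the stabiliser is mapped back by [sgval] to be seen as permutations of T.  *)
Definition point_stabiliser (T P : finType) (G : {group {perm T}})
    (toP : {action subg_of G &-> P}) (p : P) : {set {perm T}} :=
  (sgval @: 'C[p | toP])%g.

(* Main.v *)
(** The stabiliser of a point is maximal and fixes a subset, so it is the full
    stabiliser of a k-subset D with 2k < n: points are k-subsets, and, G being
    transitive on pairs of k-subsets with a given intersection size, whether
    two of them are collinear depends only on that size.

    If k-subsets meeting in k-1 elements were collinear, all points would lie
    on one line.  Exchanging one element of a point for another thus moves it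
    to a noncollinear point, and comparing intersection sizes shows that for
    distinct A, C, D on a line no two elements of {1..n} differ in membership
    of exactly one of A, C, D.  Hence D is the symmetric difference of A and C
    or its complement, and every line has exactly three points.  Choosing
    k-subsets with suitable intersections with A, C, D contradicts the
    projection axiom unless k = 2, n = 6 and the lines are the partitions of
    {1..6} into three pairs. *)
Require Import Defs.
From mathcomp Require Import zify.
From mathcomp Require Import all_boot all_fingroup all_solvable.

(** * Subsets of prescribed size and exchanges of one element *)

Lemma subset_of_card {T : finType} {D : {set T}} {m : nat} :
  m <= #|D| -> exists2 X : {set T}, X \subset D & #|X| = m.
Proof.
move=> le_mD; have: 0 < #|[set X : {set T} | X \subset D & #|X| == m]|.
  by rewrite cards_draws bin_gt0.
by case/card_gt0P=> X; rewrite inE => /andP[sXD /eqP]; exists X.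
Qed.

Definition swap {T : finType} (A : {set T}) (a b : T) : {set T} :=
  b |: (A :\ a).

Lemma card_swap {T : finType} {A : {set T}} {a b : T} :
  a \in A -> b \notin A -> #|swap A a b| = #|A|.
Proof.
move=> aA bA; rewrite /swap cardsU1 !inE (negPf bA) andbF /=.
by rewrite [in RHS](cardsD1 a) aA.
Qed.

Lemma card_swapI {T : finType} {A : {set T}} (C : {set T}) {a b : T} :
    a \in A -> b \notin A ->
  #|swap A a b :&: C| + (a \in C) = #|A :&: C| + (b \in C).
Proof.
move=> aA bA; rewrite (cardsD1 a (A :&: C)) (cardsD1 b (swap A a b :&: C)).
have ->: (swap A a b :&: C) :\ b = (A :&: C) :\ a.
  apply/setP=> u; rewrite !inE; case: (eqVneq u b) => [->|_] //=.
    by rewrite (negPf bA) andbF.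
  by rewrite andbA.
by rewrite !inE aA eqxx /=; lia.
Qed.

Lemma swapK {T : finType} {A : {set T}} {a b : T} :
  a \in A -> b \notin A -> swap (swap A a b) b a = A.
Proof.
move=> aA bA; apply/setP=> u; rewrite !inE.
case: (eqVneq u a) => [->|]; first by rewrite aA.
by case: (eqVneq u b) => [->|]; rewrite ?(negPf bA).
Qed.

(** A union of pieces of three disjoint cells; it supplies the test points with prescribed
    intersections used below. *)
Lemma subset_with_cells {T : finType} {A C : {set T}} {a c m : nat} :
    a <= #|A :\: C| -> c <= #|C :\: A| -> m <= #|~: (A :|: C)| ->
  exists X : {set T}, [/\ #|X| = a + c + m, #|X :&: A| = a, #|X :&: C| = c,
    #|X :\: (A :|: C)| = m & X :&: (A :&: C) = set0].
Proof.
case/subset_of_card=> X /subsetP sX <-; case/subset_of_card=> Y /subsetP sY <-.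
case/subset_of_card=> Z /subsetP sZ <-; exists (X :|: Y :|: Z).
have cell u : [/\ (u \in X) ==> (u \in A) && (u \notin C),
    (u \in Y) ==> (u \in C) && (u \notin A)
    & (u \in Z) ==> (u \notin A) && (u \notin C)].
  split; apply/implyP; [move/sX | move/sY | move/sZ]; rewrite !inE ?negb_or //.
    by rewrite andbC.
  by rewrite andbC.
have XA: (X :|: Y :|: Z) :&: A = X.
  apply/setP=> u; have [] := cell u; rewrite !inE.
  by case: (u \in X); case: (u \in Y); case: (u \in Z); case: (u \in A);
    case: (u \in C).
have XC: (X :|: Y :|: Z) :&: C = Y.
  apply/setP=> u; have [] := cell u; rewrite !inE.
  by case: (u \in X); case: (u \in Y); case: (u \in Z); case: (u \in A);
    case: (u \in C).
have XZ: (X :|: Y :|: Z) :\: (A :|: C) = Z.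
  apply/setP=> u; have [] := cell u; rewrite !inE.
  by case: (u \in X); case: (u \in Y); case: (u \in Z); case: (u \in A);
    case: (u \in C).
have X0: (X :|: Y :|: Z) :&: (A :&: C) = set0.
  apply/setP=> u; have [] := cell u; rewrite !inE.
  by case: (u \in X); case: (u \in Y); case: (u \in Z); case: (u \in A);
    case: (u \in C).
rewrite XA XC XZ X0; split=> //.
by rewrite -(cardsID (A :|: C)) setIUr XZ cardsU setIACA setIid X0 XA XC
  cards0 subn0.
Qed.

(** * Quadrangles whose points are the k-subsets *)

Section KSubsetQuadrangle.

Variables (T P L : finType) (inc : P -> L -> bool) (s t k : nat).
Variable f : {set T} -> P.
Hypothesis hQ : generalised_quadrangle inc.
Hypothesis hst : thick_of_order inc s t.
Hypothesis T_ge5 : 5 <= #|T|.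
Hypothesis k_small : k.*2 < #|T|.
Hypothesis f_inj : forall A B : {set T},
  #|A| = k -> #|B| = k -> f A = f B -> A = B.
Hypothesis f_surj : forall q, exists2 A : {set T}, #|A| = k & f A = q.

Implicit Types (A B C D X Y Z : {set T}) (l m : L).

Local Notation on A l := (inc (f A) l).
Local Notation col A B := (collinear inc (f A) (f B)).

(** The trace of the group action, which is transitive on pairs of k-subsets with a given
    intersection size. *)
Hypothesis f_col : forall A B A' B' : {set T},
  #|A| = k -> #|B| = k -> #|A'| = k -> #|B'| = k ->
  #|A :&: B| = #|A' :&: B'| -> col A B -> col A' B'.

Lemma collinearC A B : col A B -> col B A.
Proof. by case=> l [? ?]; exists l. Qed.

Lemma line_unique {A B l m} : #|A| = k -> #|B| = k -> A != B ->
  on A l -> on B l -> on A m -> on B m -> l = m.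
Proof.
move=> kA kB nAB; apply: (gq_line_unique hQ).
by apply: contra_neq nAB; apply: f_inj.
Qed.

(** If [C] were off [l], both [A] and [B] would be its projection on [l]. *)
Lemma no_triangle {A B C l} : #|A| = k -> #|B| = k -> A != B ->
  on A l -> on B l -> col A C -> col B C -> on C l.
Proof.
move=> kA kB nAB Al Bl AC BC; case Cl: (on C l) => //.
have [q [_ q_uniq]] := gq_projection hQ (negbT Cl).
case/eqP: nAB; apply: f_inj => //.
by rewrite -(q_uniq (f A)) ?(q_uniq (f B)) //; split=> //; apply: collinearC.
Qed.

Lemma projection {A l} : ~~ on A l ->
  exists B, [/\ #|B| = k, on B l & col A B].
Proof.
case/(gq_projection hQ) => q [[ql Aq] _]; have [B kB fB] := f_surj q.
by exists B; rewrite fB.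
Qed.

Lemma card_on_line l : #|[set B : {set T} | #|B| == k & on B l]| = s.+1.
Proof.
rewrite -(points_on_line hst l) -(card_in_imset (f := f)); last first.
  by move=> B C; rewrite !inE => /andP[/eqP kB _] /andP[/eqP kC _];
    apply: f_inj.
apply: eq_card => q; rewrite inE; apply/imsetP/idP.
  by case=> B; rewrite inE => /andP[_ Bl] ->.
by have [B kB <-] := f_surj q; exists B; rewrite // inE kB eqxx.
Qed.

Lemma third_point {A B l} : #|A| = k -> #|B| = k ->
  on A l -> on B l ->
  exists C, [/\ #|C| = k, on C l, C != A & C != B].
Proof.
move=> kA kB Al Bl.
have: 0 < #|[set C : {set T} | #|C| == k & on C l] :\ A :\ B|.
  have := thick_s hst; have := card_on_line l; rewrite (cardsD1 A) (cardsD1 B);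
    lia.
case/card_gt0P=> C; rewrite !inE => /and3P[nB nA /andP[/eqP kC Cl]].
by exists C.
Qed.

Lemma other_line A l : exists2 m, on A m & m != l.
Proof.
have: 0 < #|[set m | on A m] :\ l|.
  have := thick_t hst; rewrite -(lines_on_point hst (f A)) (cardsD1 l); lia.
by case/card_gt0P=> m; rewrite !inE => /andP[nl Am]; exists m.
Qed.

Lemma ksubset_exists : exists A : {set T}, #|A| = k.
Proof.
have [|A _ kA] := @subset_of_card T setT k; last by exists A.
by rewrite cardsT; lia.
Qed.

Lemma line_exists A : exists l, on A l.
Proof.
have: 0 < #|[set m | on A m]| by rewrite (lines_on_point hst (f A)).
by case/card_gt0P=> m; rewrite inE; exists m.
Qed.

Lemma not_all_on_line l : ~ forall A, #|A| = k -> on A l.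
Proof.
move=> all_l; have [A kA] := ksubset_exists.
have [m Am /eqP nml] := other_line A l.
have [B [kB Bm nBA _]] := third_point kA kA Am Am.
by case: nml; apply: (line_unique kB kA nBA) => //; apply: all_l.
Qed.

(** * Noncollinearity of adjacent k-subsets *)

(** Two exchanges of [A] that remove or add the same element are equal or adjacent, so with [A] they
    lie on one line. The exchange of [a0, b0] leads to that of [a, b] through [a0, b]. *)
Lemma swap_collinear_line {A} : #|A| = k ->
    (forall B C, #|B| = k -> #|C| = k -> #|B :&: C|.+1 = k -> col B C) ->
  exists2 l, on A l & forall a b, a \in A -> b \notin A -> on (swap A a b) l.
Proof.
move=> kA adj; have [k0 | k_gt0] := posnP k.
  have [l Al] := line_exists A; exists l => // a b aA.
  by move: kA; rewrite k0 (cardsD1 a) aA.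
have adjP B C : #|B| = k -> #|C| = k -> B = C \/ #|B :&: C|.+1 = k -> col B C.
  move=> kB kC [->|]; last exact: adj.
  by have [l Cl] := line_exists C; exists l.
have [a0 a0A]: exists a0, a0 \in A by apply/card_gt0P; rewrite kA.
have [b0 b0A]: exists b0, b0 \in ~: A.
  by apply/card_gt0P; move: (cardsC A) kA k_small; lia.
rewrite inE in b0A.
have kS a b : a \in A -> b \notin A -> #|swap A a b| = k.
  by move=> aA bA; rewrite card_swap.
have adjA a b : a \in A -> b \notin A -> col A (swap A a b).
  move=> aA bA; apply: adj; rewrite ?kS //.
  by have := card_swapI A aA bA; rewrite setIC setIid aA (negPf bA); lia.
have [l [Al Bl]] := adjA _ _ a0A b0A; exists l => //.
have neq c d : c \in A -> d \notin A -> A != swap A c d.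
  move=> cA dA; apply/eqP=> eA; move: dA; rewrite eA !inE eqxx //.
have step a1 b1 a b : a1 \in A -> b1 \notin A -> a \in A -> b \notin A ->
    on (swap A a1 b1) l -> a1 = a \/ b1 = b -> on (swap A a b) l.
  move=> a1A b1A aA bA S1l eq1.
  have nS := neq _ _ a1A b1A.
  apply: (no_triangle kA (kS _ _ a1A b1A) nS) => //; first exact: adjA.
  apply: adjP; rewrite ?kS //.
  have := card_swapI (swap A a b) a1A b1A.
  have := card_swapI A aA bA; rewrite setIid aA (negPf bA) setIC !inE.
  rewrite a1A (negPf b1A) andbF orbF andbT kA.
  case: (eqVneq a1 a) eq1 => [->|na] eq1.
    case: (eqVneq b1 b) => [->|nb]; first by left.
    rewrite orbF; case: (eqVneq a b) => [ab|_] /=.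
      by move: aA; rewrite ab (negPf bA).
    by rewrite !addn0 addn1 => kE ->; right.
  case: eq1 => [e|->]; first by rewrite e eqxx in na.
  by rewrite eqxx orbT /= !addn1 addn0 => kE ->; right.
move=> a b aA bA; apply: (step a0 b) => //; last by right.
by apply: (step a0 b0) => //; left.
Qed.

(** By [f_col], one collinear adjacent pair makes all such pairs collinear; the line carrying [A]
    and its exchanges then reaches every k-subset by successive exchanges. *)
Lemma adjacent_not_collinear {A B} :
  #|A| = k -> #|B| = k -> #|A :&: B|.+1 = k -> ~ col A B.
Proof.
move=> kA kB kAB AB.
have adj C D : #|C| = k -> #|D| = k -> #|C :&: D|.+1 = k -> col C D.
  move=> kC kD kCD; apply: (f_col _ _ _ _ kA kB kC kD _ AB).
  by apply: succn_inj; rewrite kAB kCD.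
pose star C l := on C l /\
  forall a b, a \in C -> b \notin C -> on (swap C a b) l.
have starS C l a b : #|C| = k -> star C l -> a \in C -> b \notin C ->
    star (swap C a b) l.
  move=> kC [Cl starC] aC bC; have kS: #|swap C a b| = k by rewrite card_swap.
  have [m Sm starS] := swap_collinear_line kS adj.
  (* Exchanging back returns to [C], so [l] and [m] share two points. *)
  suff -> : l = m by split.
  have nCS: C != swap C a b by apply/eqP=> e; move: bC; rewrite e !inE eqxx.
  apply: (line_unique kC kS nCS) => //; first exact: starC.
  rewrite -[C](swapK aC bC); apply: starS; rewrite ?inE ?eqxx //.
  by case: eqP bC aC => [->|] //= /negPf->.
have [l Al starA] := swap_collinear_line kA adj.
apply: (@not_all_on_line l) => C kC.
have [d] := ubnP #|C :\: A|; have: star A l by [].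
elim: d A kA {AB kAB Al starA} => // d IHd A kA starA ltd.
have [CA0 | [b]] := set_0Vmem (C :\: A).
  have sCA: C \subset A by rewrite -setD_eq0 CA0.
  have /eqP->: C == A by rewrite eqEcard sCA kA kC /=.
  by case: starA.
rewrite inE => /andP[bA bC].
have [a]: exists a, a \in A :\: C.
  apply/card_gt0P; move: (cardsID C A) (cardsID A C).
  by rewrite [C :&: A]setIC (cardsD1 b (C :\: A)) !inE bA bC; lia.
rewrite inE => /andP[aC aA].
apply: (IHd (swap A a b)); rewrite ?card_swap //; first exact: starS.
rewrite -ltnS; apply: leq_trans ltd; apply: proper_card; apply/properP; split.
  by apply/subsetP=> u; rewrite !inE; case: eqP => // _; case: eqP => [->|];
    rewrite ?(negPf aC).
by exists b; rewrite !inE ?bA ?eqxx.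
Qed.

(** * Three points on a line and their parity *)

Definition line_triple A C D l :=
  [/\ [/\ #|A| = k, #|C| = k & #|D| = k], [/\ on A l, on C l & on D l]
     & [/\ A != C, A != D & C != D]].

Lemma line_triple_rot {A C D l} : line_triple A C D l -> line_triple C D A l.
Proof. by case=> -[? ? ?] [? ? ?] [? ? ?]; split; split; rewrite // eq_sym. Qed.

(* Swapping u and v turns A into an adjacent, hence noncollinear, set A', which
   would be collinear to both C and D if these were invariant under the swap. *)
Lemma line_triple_separates {A C D l u v} : line_triple A C D l ->
  u \in A -> v \notin A -> (u \in C) = (v \in C) -> (u \in D) <> (v \in D).
Proof.
case=> -[kA kC kD] [Al Cl Dl] [_ _ nCD] uA vA eC eD.
have kS: #|swap A u v| = k by rewrite card_swap.
have colS B : #|B| = k -> on B l -> (u \in B) = (v \in B) -> col B (swap A u v).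
  move=> kB Bl eB; apply/collinearC.
  apply: (f_col _ _ _ _ kA kB kS kB); last by exists l.
  by have := card_swapI B uA vA; rewrite eB => /addIn ->.
have Sl := no_triangle kC kD nCD Cl Dl (colS _ kC Cl eC) (colS _ kD Dl eD).
apply: (adjacent_not_collinear kA kS); last by exists l.
have := card_swapI A uA vA.
by rewrite uA (negPf vA) setIid setIC addn0 addn1 kA.
Qed.

(** Parity refers to the number of sets among the three that contain [u], so both conditions are
    symmetric in them. *)
Definition even_triple A C D := forall u, (u \in D) = (u \in A) (+) (u \in C).
Definition odd_triple A C D :=
  forall u, (u \in D) = ~~ ((u \in A) (+) (u \in C)).

(* The membership patterns of the elements of T in A, C, D form a subset of
   the cube {0,1}^3 without two adjacent vertices; such a subset lies in one of
   the two parity classes or in a pair of antipodal vertices, and in the last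
   case two of the three sets coincide. *)
Lemma line_triple_parity {A C D l} : line_triple A C D l ->
  even_triple A C D \/ odd_triple A C D.
Proof.
move=> tACD; have [_ _ [nAC nAD nCD]] := tACD.
pose odd_at u := (u \in A) (+) (u \in C) (+) (u \in D).
have [/forallP all_odd | /forallPn[u /negPf ue]] := boolP [forall u, odd_at u].
  right=> u; move: (all_odd u); rewrite /odd_at.
  by case: (u \in A); case: (u \in C); case: (u \in D).
have [/forallP all_even | /forallPn[v]] := boolP [forall u, ~~ odd_at u].
  left=> w; move: (all_even w); rewrite /odd_at.
  by case: (w \in A); case: (w \in C); case: (w \in D).
rewrite negbK => vo.
(* Patterns of opposite parity differ in one or three coordinates, and one is excluded by
   [line_triple_separates]. *)
have opp w w' : odd_at w != odd_at w' ->
    [/\ (w \in A) = (w' \notin A), (w \in C) = (w' \notin C)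
       & (w \in D) = (w' \notin D)].
  have sA := fun u v => @line_triple_separates _ _ _ _ u v tACD.
  have tC := line_triple_rot tACD; have tD := line_triple_rot tC.
  have sC := fun u v => @line_triple_separates _ _ _ _ u v tC.
  have sD := fun u v => @line_triple_separates _ _ _ _ u v tD.
  move: (sA w w') (sA w' w) (sC w w') (sC w' w) (sD w w') (sD w' w).
  rewrite /odd_at.
  case: (w \in A); case: (w \in C); case: (w \in D);
  case: (w' \in A); case: (w' \in C); case: (w' \in D);
  move=> h1 h2 h3 h4 h5 h6 // _; exfalso;
  by [apply: h1 | apply: h2 | apply: h3 | apply: h4 | apply: h5 | apply: h6].
(* Every [w] is antipodal to [u] or to [v], so agreement at [u] spreads to all elements. *)
have same X Y : (forall w w', odd_at w != odd_at w' ->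
      (w \in X) = (w' \notin X) /\ (w \in Y) = (w' \notin Y)) ->
    (u \in X) = (u \in Y) -> X = Y.
  move=> oXY eu; have [|vX vY] := oXY v u; first by rewrite vo ue.
  have ev: (v \in X) = (v \in Y) by rewrite vX vY eu.
  apply/setP=> w; case wo: (odd_at w).
    by have [|-> ->] := oXY w u; rewrite ?wo ?ue ?eu.
  by have [|-> ->] := oXY w v; rewrite ?wo ?vo ?ev.
have [uAC | uAC] := eqVneq (u \in A) (u \in C).
  by case/eqP: nAC; apply: same => // w w' /opp[].
have [uAD | uAD] := eqVneq (u \in A) (u \in D).
  by case/eqP: nAD; apply: same => // w w' /opp[].
case/eqP: nCD; apply: same; first by move=> w w' /opp[].
by move: uAC uAD; case: (u \in A); case: (u \in C); case: (u \in D).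
Qed.

(** [D] splits into [A :\: C] and [C :\: A], both of size k - i for i = [#|A :&: C|]. *)
Lemma even_triple_card {A C D} : #|A| = k -> #|C| = k -> #|D| = k ->
  even_triple A C D -> (#|A :&: C|).*2 = k.
Proof.
move=> kA kC kD evD.
have: #|D :&: A| = #|A :\: C|.
  by apply: eq_card => u; rewrite !inE evD; case: (u \in A); case: (u \in C).
have: #|D :\: A| = #|C :\: A|.
  by apply: eq_card => u; rewrite !inE evD; case: (u \in A); case: (u \in C).
have := cardsID A D; have := cardsID C A; have := cardsID A C.
rewrite [C :&: A]setIC kA kC kD.
move: #|A :&: C| #|A :\: C| #|C :\: A| #|D :&: A| #|D :\: A|.
clear; lia.
Qed.

Lemma card_outside {A C} : #|A| = k -> #|C| = k ->
  #|~: (A :|: C)| + k.*2 = #|T| + #|A :&: C|.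
Proof.
move=> kA kC; have := cardsC (A :|: C); have := cardsUI A C; rewrite kA kC.
move: #|A :|: C| #|A :&: C| #|~: (A :|: C)| #|T|; clear; lia.
Qed.

(** [D] splits into [A :&: C] and [~: (A :|: C)], of sizes i and n - 2k + i. *)
Lemma odd_triple_card {A C D} : #|A| = k -> #|C| = k -> #|D| = k ->
  odd_triple A C D -> #|T| + #|A :&: C|.*2 = 3 * k.
Proof.
move=> kA kC kD oddD; have := card_outside kA kC.
have: #|D :&: A| = #|A :&: C|.
  by apply: eq_card => u; rewrite !inE oddD; case: (u \in A); case: (u \in C).
have: #|D :\: A| = #|~: (A :|: C)|.
  by apply: eq_card => u; rewrite !inE oddD; case: (u \in A); case: (u \in C).
have := cardsID A D; rewrite kD.
move: #|A :&: C| #|D :&: A| #|D :\: A| #|~: (A :|: C)| #|T|; clear; lia.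
Qed.

(** [X] and [D] are each the symmetric difference of [A] and [C] or its complement; different
    choices would make them complementary k-subsets, against 2k < n. *)
Lemma line_triple_all {A C D X l} : line_triple A C D l ->
  #|X| = k -> on X l -> [|| X == A, X == C | X == D].
Proof.
move=> tACD kX Xl; have [[kA kC kD] [Al Cl _] [nAC _ _]] := tACD.
have [//|nXA] := eqVneq X A; have [//|nXC] /= := eqVneq X C.
have tX: line_triple A C X l by split; split; rewrite // eq_sym.
have notC Y : #|Y| = k -> #|~: Y| = k -> False.
  by move=> kY kCY; move: (cardsC Y) k_small; rewrite kY kCY -addnn => ->;
    rewrite ltnn.
have [eD|oD] := line_triple_parity tACD; have [eX|oX] := line_triple_parity tX.
- by apply/eqP/setP=> u; rewrite eD eX.
- case: (notC X kX); rewrite -kD; apply: eq_card => u.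
  by rewrite !inE eD oX negbK.
- case: (notC D kD); rewrite -kX; apply: eq_card => u.
  by rewrite !inE oD eX negbK.
- by apply/eqP/setP=> u; rewrite oD oX.
Qed.

(** * Consequences of the projection axiom for k and n *)

Lemma line_triple_exists {A B l} : #|A| = k -> #|B| = k -> A != B ->
  on A l -> on B l -> exists D, line_triple A B D l.
Proof.
move=> kA kB nAB Al Bl; have [D [kD Dl nDA nDB]] := third_point kA kB Al Bl.
by exists D; split; split; rewrite // eq_sym.
Qed.

(* For i = #|A :&: C| > 0, the k-subset X below misses A :&: C but meets A and C
   in i elements each, so it would be a fourth point on the line. *)
Lemma odd_triple_disjoint {A C D l} : line_triple A C D l ->
  odd_triple A C D -> A :&: C = set0.
Proof.
move=> tACD oD; have [[kA kC kD] [Al Cl Dl] [nAC _ _]] := tACD.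
have [//|[z zAC]] := set_0Vmem (A :&: C).
have cAC := cardsID C A; have cCA := cardsID A C; rewrite setIC in cCA.
have cU := card_outside kA kC; have cT := odd_triple_card kA kC kD oD.
(* With i = [#|A :&: C|], the relations n + 2i = 3k and 2k < n give 2i < k, so the cells are large
   enough. *)
have [||| X [kX XA XC _ X0]] := @subset_with_cells T A C #|A :&: C| #|A :&: C|
    (k - #|A :&: C|.*2).
- by move: kA kC k_small; clear -cAC cT; lia.
- by move: kA kC k_small; clear -cCA cT; lia.
- by move: kA kC k_small; clear -cU cT; lia.
have {}kX : #|X| = k.
  by rewrite kX; move: kA kC k_small; clear -cAC cT; lia.
have AC : col A C by exists l.
have colA : col A X by apply: (f_col _ _ _ _ kA kC kA kX _ AC);
  rewrite [A :&: X]setIC XA.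
have colC : col C X by apply: (f_col _ _ _ _ kA kC kC kX _ AC);
  rewrite [C :&: X]setIC XC.
have Xl := no_triangle kA kC nAC Al Cl colA colC.
have zX : z \notin X.
  by apply/negP=> zX; have /setP/(_ z) := X0; rewrite !inE zX; move: zAC;
    rewrite inE => ->.
move: zAC; rewrite inE => /andP[zA zC]; have zD : z \in D by rewrite oD zA zC.
by case/or3P: (line_triple_all tACD kX Xl) zX => /eqP->; rewrite ?zA ?zC ?zD.
Qed.

Lemma even_triple_subU {A C D} : even_triple A C D -> D \subset A :|: C.
Proof.
move=> evD; apply/subsetP=> u; rewrite inE evD.
by case: (u \in A).
Qed.

(* If A, C, D is an even triple, the k-subset X below has so few elements inside
   A :|: C that no even triple contains X and a point of the line. *)
Lemma odd_triple_exists : exists A C D l,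
  line_triple A C D l /\ odd_triple A C D.
Proof.
have [A kA] := ksubset_exists; have [l Al] := line_exists A.
have [C [kC Cl nCA _]] := third_point kA kA Al Al.
have nAC : A != C by rewrite eq_sym.
have [D tACD] := line_triple_exists kA kC nAC Al Cl.
have [evD|] := line_triple_parity tACD; last by exists A, C, D, l.
have [[_ _ kD] _ _] := tACD.
have ki := even_triple_card kA kC kD evD.
have cAC := cardsID C A; have cU := card_outside kA kC.
have i_gt0 : 0 < #|A :&: C|.
  rewrite lt0n; apply: contra_neq nAC => i0.
  by move: ki; rewrite i0 => k0; apply/eqP; rewrite eqEcard kC kA leqnn andbT;
    rewrite (cards0_eq (etrans kA (esym k0))) sub0set.
(* Here k = 2i. All points of [l] lie in [A :|: C], which contains only i - 1 elements of [X], while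
   two points of an even triple meet in i. The i + 1 elements outside exist since 2k < n. *)
have [||| X [kX XA XC XU X0]] :=
  @subset_with_cells T A C #|A :&: C|.-1 0 #|A :&: C|.+1.
- by move: kA; clear -cAC ki; lia.
- by [].
- by move: k_small; clear -cU ki; lia.
have {}kX : #|X| = k by rewrite kX; clear -ki i_gt0; lia.
have XUI B : #|B| = k -> on B l -> #|X :&: B| < #|A :&: C|.
  move=> kB Bl; have sB : B \subset A :|: C.
    case/or3P: (line_triple_all tACD kB Bl) => /eqP->;
      rewrite ?subsetUl ?subsetUr //.
    exact: even_triple_subU.
  apply: (@leq_ltn_trans #|X :&: (A :|: C)|); first exact/subset_leq_card/setIS.
  rewrite setIUr; apply: (leq_ltn_trans (leq_card_setU _ _)).
  by rewrite XA XC addn0 prednK.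
have nXl : ~~ on X l.
  by apply/negP=> /(XUI X kX); rewrite setIid kX; clear -ki; lia.
have [B [kB Bl [m [Xm Bm]]]] := projection nXl.
have nXB : X != B by apply: contraNneq nXl => ->.
have [E tXBE] := line_triple_exists kX kB nXB Xm Bm.
have [evE|] := line_triple_parity tXBE; last by exists X, B, E, m.
have [[_ _ kE] _ _] := tXBE; have := even_triple_card kX kB kE evE.
by move: (XUI B kB Bl); clear -ki; lia.
Qed.

(* An odd triple A, C, D is a partition of T.  If k > 2, some k-subset X meets
   all three parts, and is collinear to a part B; the line through X and B is
   then an even triple, so 2 * #|X :&: B| = k, and the k-subset Y with half of
   its elements in A and half in C would be collinear to both A and C. *)
Lemma pairs_of_six :
  [/\ #|T| = 6, k = 2
    & forall A C, #|A| = k -> #|C| = k -> A :&: C = set0 -> col A C].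
Proof.
have [A [C [D [l [tACD oD]]]]] := odd_triple_exists.
have [[kA kC kD] [Al Cl Dl] [nAC _ _]] := tACD.
have AC0 := odd_triple_disjoint tACD oD.
have AC : col A C by exists l.
have disj_col X Y : #|X| = k -> #|Y| = k -> X :&: Y = set0 -> col X Y.
  move=> kX kY XY0; apply: (f_col _ _ _ _ kA kC kX kY _ AC).
  by rewrite AC0 XY0.
have cT := odd_triple_card kA kC kD oD; rewrite AC0 cards0 addn0 in cT.
(* Since n = 3k and n >= 5, the case k <= 2 leaves only k = 2. *)
have [k_gt2 | k_le2] := ltnP 2 k; last by split=> //; move: T_ge5;
  clear -cT k_le2; lia.
have cAC := cardsID C A; have cCA := cardsID A C; rewrite setIC in cCA.
have cU := card_outside kA kC.
rewrite AC0 cards0 add0n in cAC; rewrite AC0 cards0 add0n in cCA;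
  rewrite AC0 cards0 addn0 in cU.
have [||| X [kX XA XC XU _]] := @subset_with_cells T A C 1 1 (k - 2).
- by rewrite cAC kA ltnW // ltnW.
- by rewrite cCA kC ltnW // ltnW.
- by clear -cU cT; lia.
have {}kX : #|X| = k by rewrite kX; clear -k_gt2; lia.
have DU : D = ~: (A :|: C).
  apply/setP=> u; rewrite !inE oD; move/setP/(_ u): AC0; rewrite !inE.
  by case: (u \in A); case: (u \in C).
have XI B : #|B| = k -> on B l -> 0 < #|X :&: B| < k.
  move=> kB Bl; case/or3P: (line_triple_all tACD kB Bl) => /eqP->.
  - by rewrite XA; clear -k_gt2; lia.
  - by rewrite XC; clear -k_gt2; lia.
  - by rewrite DU -setDE XU; clear -k_gt2; lia.
have nXl : ~~ on X l.
  by apply/negP=> /(XI X kX); rewrite setIid kX ltnn andbF.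
have [B [kB Bl [m [Xm Bm]]]] := projection nXl.
have nXB : X != B by apply: contraNneq nXl => ->.
have [E tXBE] := line_triple_exists kX kB nXB Xm Bm.
have [evE|oE] := line_triple_parity tXBE; last first.
  by have := XI B kB Bl; rewrite (odd_triple_disjoint tXBE oE) cards0.
have [[_ _ kE] _ _] := tXBE; have kj := even_triple_card kX kB kE evE.
have j_gt0 := XI B kB Bl.
have [||| Y [kY YA YC _ _]] := @subset_with_cells T A C #|X :&: B| #|X :&: B| 0.
- by rewrite cAC kA; clear -kj; lia.
- by rewrite cCA kC; clear -kj; lia.
- by [].
have {}kY : #|Y| = k by rewrite kY; clear -kj; lia.
have XB : col X B by exists m.
have colA : col A Y.
  by apply: (f_col _ _ _ _ kX kB kA kY _ XB); rewrite [A :&: Y]setIC YA.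
have colC : col C Y.
  by apply: (f_col _ _ _ _ kX kB kC kY _ XB); rewrite [C :&: Y]setIC YC.
have Yl := no_triangle kA kC nAC Al Cl colA colC.
have YD : D :&: A = set0.
  by apply/setP=> u; rewrite DU !inE; case: (u \in A); rewrite ?andbF.
(* [Y] equal to [A] or [C] would force [#|X :&: B|] to be k, and [Y] equal to [D] would force it to
   be 0. *)
case/or3P: (line_triple_all tACD kY Yl) => /eqP eY; move: YA YC j_gt0;
  rewrite eY.
- by rewrite setIid kA => <-; rewrite ltnn andbF.
- by rewrite setIid kC => _ <-; rewrite ltnn andbF.
- by rewrite YD cards0 => <-.
Qed.

(** * Order of the quadrangle *)

(** For t, count the 6 pairs disjoint from [A]: each is on one line through [A], and each of the t +
    1 lines through [A] carries two of them. *)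
Lemma ksubset_quadrangle_order : [/\ #|T| = 6, s = 2 & t = 2].
Proof.
have [T6 k2 disj_col] := pairs_of_six.
have [A [C [D [l [tACD _]]]]] := odd_triple_exists.
have [[kA kC kD] [Al Cl Dl] [nAC nAD nCD]] := tACD.
have s2 : s = 2.
  apply: succn_inj; rewrite -(card_on_line l).
  have ->: [set B : {set T} | #|B| == k & on B l] = [set A; C; D].
    apply/setP=> B; rewrite !inE -orbA; apply/andP/idP.
      by case=> /eqP kB Bl; apply: (line_triple_all tACD).
    by case/or3P=> /eqP->; rewrite ?kA ?kC ?kD eqxx.
  by rewrite -setUA cardsU1 !inE negb_or nAC nAD cards2 nCD.
split=> //.
pose S := [set B : {set T} | B \subset ~: A & #|B| == 2].
have cS : #|S| = 6.
  by rewrite cards_draws cardsCs setCK T6 kA k2.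
have lines1 B : B \in S -> \sum_(m | on A m) (on B m : nat) = 1.
  rewrite inE => /andP[sBA /eqP kB]; rewrite -k2 in kB.
  have AB0 : A :&: B = set0.
    by apply/eqP; rewrite setIC setI_eq0 disjoints_subset.
  have nAB : A != B.
    by apply/eqP=> eAB; move: kB; rewrite -(setIid B) -{1}eAB AB0 cards0 k2.
  have [m [Am Bm]] := disj_col A B kA kB AB0.
  rewrite (bigD1 m) //= Bm big1 // => m' /andP[Am' nm].
  apply/eqP; rewrite eqb0; apply: contraNN nm => Bm'.
  by apply/eqP; apply: (line_unique kA kB nAB).
have points2 m : on A m -> \sum_(B in S) (on B m : nat) = 2.
  move=> Am; transitivity #|[set B in S | on B m]|.
    by rewrite -sum1dep_card big_mkcondr; apply: eq_bigr => B _; case: (on B m).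
  have := card_on_line m; rewrite (cardsD1 A) !inE kA eqxx Am s2 => -[<-].
  apply: eq_card => B; rewrite !inE k2 -andbA; apply/and3P/and3P.
    case=> sB kB Bm; split=> //; apply: contraTneq sB => ->.
    by rewrite -disjoints_subset -setI_eq0 setIid -cards_eq0 kA k2.
  case=> nBA kB Bm; split=> //; rewrite -disjoints_subset -setI_eq0 setIC.
  (* Distinct pairs that meet share exactly one element, so they are adjacent and not collinear. *)
  apply/negPn/negP=> nAB0; have kB2 : #|B| = k by rewrite k2; apply/eqP.
  apply: (adjacent_not_collinear kA kB2); last by exists m.
  apply/eqP; rewrite k2 eqSS eqn_leq; apply/andP; split;
    last by rewrite lt0n cards_eq0.
  rewrite -ltnS -[2]k2 -kA proper_card // properE subsetIl subsetI subxx /=.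
  by apply: contra nBA => sAB; rewrite eq_sym eqEcard sAB kA kB2 /=.
have : \sum_(B in S) \sum_(m | on A m) (on B m : nat) =
  \sum_(m | on A m) \sum_(B in S) (on B m : nat).
  by rewrite exchange_big.
rewrite (eq_bigr _ lines1) (eq_bigr _ points2) !sum_nat_const !muln1 cS.
rewrite -cardsE (lines_on_point hst (f A)); lia.
Qed.

End KSubsetQuadrangle.

(** * Transitivity of the alternating group on pairs of sets *)

Lemma imset_permM {T : finType} (x y : {perm T}) (A : {set T}) :
  (x * y)%g @: A = y @: (x @: A).
Proof. by rewrite -imset_comp; apply: eq_imset => u; rewrite permM. Qed.

Lemma mem_imset_perm {T : finType} (x : {perm T}) (A : {set T}) u :
  (x u \in x @: A) = (u \in A).
Proof. exact/mem_imset/perm_inj. Qed.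

Lemma imset_permC {T : finType} (x : {perm T}) (A : {set T}) :
  x @: (~: A) = ~: (x @: A).
Proof.
by apply/setP=> u; rewrite -(permKV x u) inE !mem_imset_perm inE.
Qed.

(** Colour elements by membership in the two sets; equal colour counts give a permutation. If it is
    odd, two of the n >= 5 elements share one of the four colours, and their transposition corrects
    the parity. *)
Lemma alt_pair_transitive {n : nat} {A B A' B' : {set 'I_n}} : 5 <= n ->
    #|A| = #|A'| -> #|B| = #|B'| -> #|A :&: B| = #|A' :&: B'| ->
  exists2 x : {perm 'I_n}, x \in ('Alt_('I_n))%g & x @: A = A' /\ x @: B = B'.
Proof.
move=> n5 eA eB eAB.
pose key (X Y : {set 'I_n}) u := (u \in X, u \in Y).
suffices [x xalt keyx]: exists2 x : {perm 'I_n}, x \in ('Alt_('I_n))%g &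
    forall u, key A B u = key A' B' (x u).
  exists x => //; split; apply/setP=> u; rewrite -(permKV x u) mem_imset_perm;
  by case: (keyx (x^-1 u)%g).
have [x keyx]: exists x : {perm 'I_n}, forall u, key A B u = key A' B' (x u).
  pose tup X Y := [tuple key X Y i | i < n].
  suffices /tuple_permP[x tupx]: perm_eq (tup A B) (tup A' B').
    exists x => u; have := congr1 (fun w => tnth w u) (val_inj tupx).
    by rewrite !tnth_mktuple.
  have cnt X Y v : count_mem v (tup X Y) = #|[set i | key X Y i == v]|.
    by rewrite -sum1_count big_map big_enum_cond sum1dep_card.
  apply/allP=> v _; apply/eqP; rewrite /= !cnt.
  have key_tt X Y : [set i | key X Y i == (true, true)] = X :&: Y.
    by apply/setP=> i; rewrite !inE /key xpair_eqE !eqb_id.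
  have key_tf X Y : [set i | key X Y i == (true, false)] = X :\: Y.
    by apply/setP=> i; rewrite !inE /key xpair_eqE eqb_id eqbF_neg andbC.
  have key_ft X Y : [set i | key X Y i == (false, true)] = Y :\: X.
    by apply/setP=> i; rewrite !inE /key xpair_eqE eqb_id eqbF_neg.
  have key_ff X Y : [set i | key X Y i == (false, false)] = ~: (X :|: Y).
    by apply/setP=> i; rewrite !inE /key xpair_eqE !eqbF_neg negb_or.
  case: v => [[] []]; rewrite ?key_tt ?key_tf ?key_ft ?key_ff //.
  - by rewrite !cardsD eA eAB.
  - by rewrite !cardsD eB setIC eAB setIC.
  - by rewrite [LHS]cardsCs [RHS]cardsCs !setCK !cardsU eA eB eAB.
have [xodd | xeven] := boolP (odd_perm x); last by exists x; rewrite ?Alt_even.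
have /injectivePn[u [v nuv keyuv]]: ~~ injectiveb (key A B).
  apply/injectiveP=> /leq_card; rewrite card_ord card_prod card_bool.
  by rewrite leqNgt n5.
exists (tperm u v * x)%g; first by rewrite Alt_even odd_mul_tperm nuv xodd.
by move=> w; rewrite permM -keyx; case: tpermP => [->|->|].
Qed.

(** * The point stabiliser as the stabiliser of a subset *)

Section IntransitiveStabiliser.

Variables (n : nat) (G : {group {perm 'I_n}}) (P : finType).
Variables (toP : {action subg_of G &-> P}) (p : P).
Hypothesis n_ge5 : 5 <= n.
Hypothesis altG : ('Alt_('I_n))%g \subset G.
Hypothesis primP : [primitive [set: subg_of G], on [set: P] | toP].
Hypothesis intrP :
  ~~ [transitive (point_stabiliser toP p), on [set: 'I_n] | 'P].

Implicit Types (F : {set {set 'I_n}}) (D : {set 'I_n}) (g : subg_of G).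

Lemma pair_transitive {A B A' B' : {set 'I_n}} :
    #|A| = #|A'| -> #|B| = #|B'| -> #|A :&: B| = #|A' :&: B'| ->
  exists g, sgval g @: A = A' /\ sgval g @: B = B'.
Proof.
move=> eA eB eAB; have [x xalt xAB] := alt_pair_transitive n_ge5 eA eB eAB.
by exists (Subg (subsetP altG x xalt)).
Qed.

(** Families cover both a single set and a set paired with its complement. Forward invariance
    suffices: in a finite group, closure under products gives a subgroup. *)
Definition family_stab (F : {set {set 'I_n}}) : {set subg_of G} :=
  [set g : subg_of G | [forall D in F, (sgval g @: D) \in F]].

Lemma family_stabP {F g} :
  reflect (forall D, D \in F -> sgval g @: D \in F) (g \in family_stab F).
Proof. by rewrite inE; apply: (iffP forall_inP). Qed.

Lemma family_stab_group_set F : group_set (family_stab F).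
Proof.
apply/group_setP; split; first by apply/family_stabP=> D; rewrite imset_perm1.
move=> g h /family_stabP gF /family_stabP hF; apply/family_stabP=> D /gF/hF.
by rewrite -imset_permM.
Qed.

Canonical family_stab_group F := Group (family_stab_group_set F).

Lemma mem_stab1 D g : (g \in family_stab [set D]) = (sgval g @: D == D).
Proof.
apply/family_stabP/eqP=> [/(_ D (set11 D))/set1P // | gD E /set1P->].
by rewrite gD set11.
Qed.

Lemma stabiliser_maximal F : 'C[p | toP]%g \subset family_stab F ->
  family_stab F = 'C[p | toP]%g \/ family_stab F = setT.
Proof.
move=> sCF; have [trP _] := andP primP.
have := primP; rewrite (trans_prim_astab (in_setT p) trP) setTI.
case/maximal_eqP=> _ /(_ (family_stab_group F)) maxC.
exact: maxC sCF (subsetT _).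
Qed.

Lemma proper_moved D : 0 < #|D| < n ->
  exists2 D' : {set 'I_n}, #|D'| = #|D| & #|D :&: D'|.+1 = #|D|.
Proof.
case/andP=> D_gt0 D_ltn; have [a aD] := card_gt0P D_gt0.
have /card_gt0P[b]: 0 < #|~: D|.
  by have := cardsC D; rewrite card_ord; clear -D_ltn; lia.
rewrite inE => bD; exists (swap D a b); first by rewrite card_swap.
by have := card_swapI D aD bD; rewrite setIid aD (negPf bD) setIC addn0 addn1.
Qed.

(** An orbit [D] of the point stabiliser is proper by intransitivity and is moved by the group, so
    maximality makes the point stabiliser the full stabiliser of [D]. If 2 * #|D| > n, the
    complement serves instead. *)
Lemma stabiliser_of_subset : exists2 D : {set 'I_n}, #|D|.*2 < n &
  forall g, (g \in 'C[p | toP]%g) = (sgval g @: D == D).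
Proof.
pose i0 : 'I_n := Ordinal (leq_trans (isT : 0 < 5) n_ge5).
pose D := [set sgval h i0 | h : subg_of G in 'C[p | toP]%g].
have D_ltn : 0 < #|D| < n.
  apply/andP; split.
    apply/card_gt0P; exists (sgval (1%g : subg_of G) i0).
    by apply: imset_f; apply: group1.
  have DT: D != setT.
    apply: contraNneq intrP => DT; apply/imsetP; exists i0; rewrite ?inE //.
    by rewrite orbitE /point_stabiliser -imset_comp -DT; apply: eq_imset.
  by have := proper_card (_ : D \proper setT); rewrite properT cardsT card_ord;
    apply.
have sCD : 'C[p | toP]%g \subset family_stab [set D].
  apply/subsetP=> g Cg;
    rewrite mem_stab1 eqEcard (card_imset _ perm_inj) leqnn andbT.
  apply/subsetP=> _ /imsetP[_ /imsetP[h Ch ->] ->].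
  by rewrite -permM;
    apply: (imset_f (fun h : subg_of G => sgval h i0) (groupM Ch Cg)).
have [D' kD' iDD'] := proper_moved _ D_ltn.
have stabD : family_stab [set D] = 'C[p | toP]%g.
  case: (stabiliser_maximal _ sCD) => // stabT.
  have [g [gD _]] : exists g, sgval g @: D = D' /\ sgval g @: D = D'.
    by apply: pair_transitive; rewrite ?kD' // !setIid kD'.
  have: g \in family_stab [set D] by rewrite stabT inE.
  rewrite mem_stab1 gD => /eqP eD.
  by move: iDD'; rewrite eD setIid => /eqP; rewrite eqn_leq ltnn.
have stabE g : (g \in 'C[p | toP]%g) = (sgval g @: D == D).
  by rewrite -stabD mem_stab1.
have [ltD | gtD | eqD] := ltngtP #|D|.*2 n; first by exists D.
  exists (~: D).
    by have := cardsC D; rewrite card_ord; clear -gtD; lia.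
  by move=> g; rewrite stabE imset_permC (inj_eq (can_inj (@setCK _))).
(* If 2 * #|D| = n, the stabiliser of this pair would lie strictly between the point stabiliser and
   the whole group. *)
pose F := [set D; ~: D].
have cDC : #|~: D| = #|D|.
  by have := cardsC D; rewrite card_ord; clear -eqD; lia.
have sCF : 'C[p | toP]%g \subset family_stab F.
  apply/subsetP=> g; rewrite stabE => /eqP gD; apply/family_stabP=> E.
  by case/set2P=> ->; rewrite ?imset_permC gD ?set21 ?set22.
have [stabF | stabF] := stabiliser_maximal _ sCF.
  have [g [gD gDC]] : exists g, sgval g @: D = ~: D /\ sgval g @: (~: D) = D.
    by apply: pair_transitive; rewrite ?cDC // setIC.
  have: g \in family_stab F.
    by apply/family_stabP=> E /set2P[]->; rewrite ?gD ?gDC ?set21 ?set22.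
  rewrite stabF stabE gD => /eqP DC; have [a] : exists a, a \in D.
    by apply/card_gt0P; case/andP: D_ltn.
  by move=> aD; have := aD; rewrite -DC inE aD.
have [g [gD _]] : exists g, sgval g @: D = D' /\ sgval g @: D = D'.
  by apply: pair_transitive; rewrite ?kD' // !setIid kD'.
have: g \in family_stab F by rewrite stabF inE.
move/family_stabP/(_ D (set21 _ _)).
rewrite gD => /set2P[] eD; move: iDD'; rewrite eD.
  by rewrite setIid => /eqP; rewrite eqn_leq ltnn.
by rewrite setICr cards0; clear -n_ge5 eqD; lia.
Qed.

End IntransitiveStabiliser.

(** * Identification of the points with k-subsets *)

Theorem theorem5p8 (n : nat) (G : {group {perm 'I_n}})
  (hn : 5 <= n)
  (hG : (G : {set {perm 'I_n}}) = ('Alt_('I_n))%g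
        \/ (G : {set {perm 'I_n}}) = ('Sym_('I_n))%g)
  (P L : finType) (inc : P -> L -> bool) (s t : nat)
  (hQ : generalised_quadrangle inc)
  (hst : thick_of_order inc s t)
  (toP : {action subg_of G &-> P}) (toL : {action subg_of G &-> L})
  (haut : acts_as_automorphisms inc toP toL)
  (hprim : [primitive [set: subg_of G], on [set: P] | toP])
  (p : P)
  (hintr : ~~ [transitive (point_stabiliser toP p), on [set: 'I_n] | 'P]) :
  n = 6 /\ s = 2 /\ t = 2.
Proof.
have altG : ('Alt_('I_n))%g \subset G.
  by case: hG => ->; [exact: subxx | exact: Alt_subset].
have [D D_small stabD] := @stabiliser_of_subset n G P toP p hn altG hprim hintr.
have moved (A : {set 'I_n}) : #|A| = #|D| ->
    exists g : subg_of G, sgval g @: D = A.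
  move=> kA; have [|||g []] := @pair_transitive n G hn altG D D A A;
    rewrite ?setIid //.
  by exists g.
(* The choice of [g] is immaterial, as two choices differ by an element fixing [D] and hence [p].
   The default [p] never occurs on sets of size [#|D|], by [moved]. *)
pose f (A : {set 'I_n}) : P :=
  if [pick g : subg_of G | sgval g @: D == A] is Some g then toP p g else p.
have fE (g : subg_of G) : f (sgval g @: D) = toP p g.
  rewrite /f; case: pickP => [h /eqP hD | /(_ g)]; last by rewrite eqxx.
  have /astab1P : (h * g^-1)%g \in 'C[p | toP]%g.
    by rewrite stabD imset_permM hD -imset_permM mulgV imset_perm1.
  by rewrite actM => /(canRL (actKV toP g)).
have f_inj (A B : {set 'I_n}) : #|A| = #|D| ->
  #|B| = #|D| -> f A = f B -> A = B.
  case/moved=> g <-; case/moved=> h <-; rewrite !fE => eqp.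
  have : (g * h^-1)%g \in 'C[p | toP]%g by apply/astab1P; rewrite actM eqp actK.
  rewrite stabD imset_permM => /eqP eD.
  by rewrite -[in RHS]eD -!imset_permM mulgVK.
have f_surj q : exists2 A : {set 'I_n}, #|A| = #|D| & f A = q.
  have [/atransP/(_ p (in_setT p)) trP _] := andP hprim.
  have : q \in orbit toP [set: subg_of G] p by rewrite trP.
  case/orbitP=> g _ <-; exists (sgval g @: D); last exact: fE.
  by rewrite card_imset //; apply: perm_inj.
have f_col (A B A' B' : {set 'I_n}) : #|A| = #|D| -> #|B| = #|D| ->
  #|A'| = #|D| -> #|B'| = #|D| ->
    #|A :&: B| = #|A' :&: B'| ->
    collinear inc (f A) (f B) -> collinear inc (f A') (f B').
  move=> kA kB kA' kB' eAB [l [Al Bl]].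
  have [|||g [gA gB]] := @pair_transitive n G hn altG A B A' B';
    rewrite ?kA ?kB //.
  have fM (X : {set 'I_n}) : #|X| = #|D| -> f (sgval g @: X) = toP (f X) g.
    by case/moved=> h <-;
      rewrite -imset_permM -[(_ * _)%g]/(sgval (h * g)%g) !fE actM.
  by exists (toL l g); rewrite -gA -gB !fM // !haut.
have [||n6 -> ->] :=
  @ksubset_quadrangle_order 'I_n P L inc s t #|D| f hQ hst _ _
  f_inj f_surj f_col; rewrite ?card_ord //.
by rewrite -[n]card_ord.
Qed.
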